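(* Let $P$ be a finite bounded graded poset with $|P|>1$, let $r$ be a rational with $0\le r<1$, and let $A$ be a nontrivial antichain in $P$. Then $$\mathbf I_r(P,A;\rho)=\Bigl(\bigcap_{a\in A}\mathfrak I(a)-\{\hat0_P\}\Bigr)\ \cup\bigcup_{k\in\mathcal D_r(P,A;\rho)}\Bigl(P^{(k)}\cap\mathfrak F\bigl(\mathsf b_{\nu(rk)-1}(A)\bigr)\Bigr),$$ and also $$\mathbf I_r(P,A;\rho)=\Bigl(\bigcap_{a\in A}\mathfrak I(a)-\{\hat0_P\}\Bigr)\ \cup\ \bigcap_{a\in A}\ \bigcup_{f\in\mathcal F(P,a;\rho):\ \mathfrak f_{P,a;\rho}(r)<f}\ \ \bigcup_{\substack{s\in[1,\ \min\{\lfloor\rho(a)/\underline f\rfloor,\ \lfloor\rho(P)/\overline f\rfloor\}]:\\ s\overline f\in\mathcal D_r(P,A;\rho)}}\Bigl(P^{(s\overline f)}\cap\bigl(\mathfrak F(\mathsf b_{s\underline f-1}(a))-\mathfrak F(\mathsf b_{s\underline f}(a))\bigr)\Bigr),$$ where all blockers are taken w.r.t. $\rho$.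
   Context: $P$ is a finite poset with least element $\hat0_P$ and greatest element $\hat1_P$, graded with rank function $\rho$; $\rho(P):=\rho(\hat1_P)$ and $P^{(k)}=\{p\in P:\rho(p)=k\}$. For $A\subseteq P$, $\mathfrak I(A)=\{p: p\le a\text{ for some }a\in A\}$, $\mathfrak F(A)=\{p: p\ge a\text{ for some }a\in A\}$; $\mathfrak I(a):=\mathfrak I(\{a\})$; $\max Q$, $\min Q$ are maximal/minimal elements of $Q$. $\mathfrak{A}_{\vartriangle}(P)$: all antichains (including empty) ordered by $\mathfrak I(A')\subseteq\mathfrak I(A'')$, with meet $A'\wedge_{\vartriangle}A''=\max(\mathfrak I(A')\cap\mathfrak I(A''))$. Trivial antichains: $\emptyset$ and $\{\hat0_P\}$. The map $\rho$ is extended to antichains by $\rho(\emptyset)=-1$ and $\rho(B)=\max_{b\in B}\rho(b)$ for nonempty antichains $B$. $\mathbf I_r(P,A;\rho)$ is the set of $b\in P\setminus\{\hat0_P\}$ with $\rho(\{b\}\wedge_{\vartriangle}\{a\})/\rho(b)>r$ for all $a\in A$. Absolute $j$-blocker ($0\le j<\rho(P)$, $B$ a nontrivial antichain): $\mathsf b_j(B)=\min\{b\in P: \rho(\{b\}\wedge_{\vartriangle}\{c\})>j\ \forall c\in B\}$, with the convention $\mathsf b_{\rho(P)}(B)=\emptyset$; $\mathsf b_j(a):=\mathsf b_j(\{a\})$. For positive integers $k$, $\nu(rk):=\lceil rk\rceil$ if $rk\notin\mathbb N$ and $\nu(rk):=rk+1$ if $rk\in\mathbb N$. For $a\in P\setminus\{\hat0_P\}$,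 $\mathcal F(P,a;\rho)$ is the ascending sequence consisting of $\tfrac01,\tfrac11$ and the reduced forms of the fractions $\rho(\{b\}\wedge_{\vartriangle}\{a\})/\rho(b)$, $b\in P\setminus\{\hat0_P\}$; $\mathfrak f_{P,a;\rho}(r):=\max\{f\in\mathcal F(P,a;\rho): f\le r\}$. For a fraction $f$ in lowest terms, $\underline f$ is its numerator and $\overline f$ its denominator. Define $$\mathcal D_r(P,A;\rho):=\bigcap_{a\in A}\Biggl(\bigcup_{f\in\mathcal F(P,a;\rho):\ \mathfrak f_{P,a;\rho}(r)<f<\frac11}\Bigl\{s\overline f:\ 1\le s\le\min\{\lfloor\rho(a)/\underline f\rfloor,\lfloor\rho(P)/\overline f\rfloor\}\Bigr\}\ \cup\ \{\rho(e): e\in\mathfrak I(a)-\{\hat0_P\}\}\Biggr).$$ $[1,j]=\{1,\dots,j\}$. *)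

(* Defs.v *)
From HB Require Import structures.
From mathcomp Require Import all_boot all_order all_algebra.
Set Implicit Arguments.
Unset Strict Implicit.
Unset Printing Implicit Defensive.
Import Order.TTheory GRing.Theory Num.Theory.
Local Open Scope order_scope.

Section PosetNotions.
Context {d : Order.disp_t} {P : finTBPOrderType d}.
Implicit Types (a b x y : P) (A B : {set P}) (rho : P -> nat) (r : rat).

Definition covers x y := (x < y) && [forall z, ~~ (x < z < y)].

(* A finite bounded poset is graded iff it has such a function, which is then
   unique. *)
Definition rank_function rho :=
  rho \bot = 0%N /\ (forall x y, covers x y -> rho y = (rho x).+1).

Definition level rho k : {set P} := [set p | rho p == k].

Definition ideal A : {set P} := [set p | [exists a in A, p <= a]].
Definition ofilter A : {set P} := [set p | [exists a in A, a <= p]].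
Definition maxs A : {set P} := [set x in A | [forall y in A, ~~ (x < y)]].
Definition mins A : {set P} := [set x in A | [forall y in A, ~~ (y < x)]].

Definition antichain A := [forall x in A, forall y in A, (x <= y) ==> (x == y)].
Definition nontrivial_antichain A :=
  [&& antichain A, A != set0 & A != [set \bot]].

Definition ameet A B : {set P} := maxs (ideal A :&: ideal B).

Definition arank rho A : int :=
  (if A == set0 then -1 else (\max_(b in A) rho b)%N%:Z)%R.

Definition meet_ratio rho a b : rat :=
  ((arank rho (ameet [set b] [set a]))%:~R / (rho b)%:R)%R.

(* The set I_r(P, A; rho). *)
Definition relset rho r A : {set P} :=
  [set b | (b != \bot) && [forall a in A, (r < meet_ratio rho a b)%R]].

Definition blocker rho j A : {set P} :=
  if (j < rho \top)%N then
    mins [set b | [forall c in A, (j%:Z < arank rho (ameet [set b] [set c]))%R]]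
  else set0.

Definition nu (q : rat) : nat :=
  if q \is a Num.nat then (Num.truncn q).+1 else `|Num.ceil q|%N.

(* A rational number stands for its reduced fraction, with numerator [numq]
   and denominator [denq]. *)
Definition Farey rho a : seq rat :=
  sort <=%R (undup [:: 0%R, 1%R & [seq meet_ratio rho a b | b in [set~ \bot]]]).

(* The default 0 of the maximum is itself in [Farey rho a], and is at most r
   whenever 0 <= r. *)
Definition Farey_pred rho a r : rat :=
  (\big[Num.max/0]_(f <- Farey rho a | f <= r) f)%R.

Definition fnum (f : rat) : nat := `|numq f|%N.
Definition fden (f : rat) : nat := `|denq f|%N.

Definition multipliers rho a (f : rat) : seq nat :=
  iota 1 (minn (rho a %/ fnum f) (rho \top %/ fden f)).

(* The set intersected over a in A in the definition of D_r(P, A; rho). *)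
Definition Dset1 rho r a : seq nat :=
  flatten [seq [seq (s * fden f)%N | s <- multipliers rho a f]
          | f <- Farey rho a & (Farey_pred rho a r < f < 1)%R]
  ++ [seq rho e | e in ideal [set a] :\ \bot].

(* D_r(P, A; rho), listed without repetition. Scanning only 0, ..., rho \top
   loses nothing: see [mem_Dset]. *)
Definition Dset rho r A : seq nat :=
  [seq k <- iota 0 (rho \top).+1 | [forall a in A, k \in Dset1 rho r a]].

Lemma rank_lt rho x y : rank_function rho -> x < y -> (rho x < rho y)%N.
Proof.
move=> [_ rhoC].
have [n] := ubnP #|[set w | x < w < y]|.
elim: n x y => // n IHn x y ltn xy.
have [/existsP[z xzy]|nz] := boolP [exists z, x < z < y]; last first.
  by rewrite (rhoC x y) // /covers xy -negb_exists.
have /andP[xz zy] := xzy.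
have sub u v : x <= u -> v <= y -> ~~ (u < z < v) ->
    (#|[set w | (u < w < v)%O]| < n)%N.
  move=> xu vy zuv; rewrite -ltnS; apply: leq_trans ltn.
  rewrite ltnS; apply: proper_card; apply/properP; split; last first.
    by exists z; rewrite inE.
  apply/subsetP=> w; rewrite !inE => /andP[uw wv].
  by rewrite (le_lt_trans xu uw) (lt_le_trans wv vy).
apply: (@ltn_trans (rho z)); apply: IHn => //; apply: sub => //.
- exact: ltW.
- by rewrite ltxx andbF.
- exact: ltW.
- by rewrite ltxx.
Qed.

Lemma mem_Dset rho r A k : rank_function rho -> A != set0 ->
  (k \in Dset rho r A) = [forall a in A, k \in Dset1 rho r a].
Proof.
move=> rhoP /set0Pn[a aA]; rewrite mem_filter mem_iota add0n ltnS /=.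
apply: andb_idr => /forall_inP/(_ a aA).
rewrite mem_cat => /orP[/flatten_mapP[f _ /mapP[s]]|/imageP[e _ ->]].
  rewrite mem_iota add1n ltnS leq_min => /and3P[_ _ sf] ->.
  exact: leq_trans (leq_mul sf (leqnn _)) (leq_divM _ _).
have [->//|] := eqVneq e \top; rewrite -ltx1 => e1.
exact/ltnW/rank_lt.
Qed.


End PosetNotions.

(* Main.v *)
(* Write m(a, b) for the largest rank of a common lower bound of a and b, so
   that a nonzero b lies in I_r(P, A) iff r rho(b) < m(a, b) for all a in A. As m is
   monotone in b, the filter of the blocker b_j(A) consists of the b with
   j < m(a, b) for all a in A. Since nu(rk) - 1 = floor(rk), this filter cuts
   I_r(P, A) out of the level k. The levels that can occur are read off the
   reduced fraction f of m(a, b) / rho(b): with s = gcd(m(a, b), rho(b)), rho(b)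
   is s times the denominator of f and m(a, b) is s times its numerator. *)
Require Import Defs.
From mathcomp Require Import all_boot all_order all_algebra.
Import Order.TTheory GRing.Theory Num.Theory.

Lemma in_bigcup_seq (T : finType) (I : Type) (s : seq I) (p : pred I)
    (F : I -> {set T}) x :
  (x \in \bigcup_(i <- s | p i) F i) = has (fun i => p i && (x \in F i)) s.
Proof.
rewrite (big_morph (fun B : {set T} => x \in B) (id1 := false) (op1 := orb)).
- by rewrite big_has_cond.
- by move=> B C; rewrite inE.
- by rewrite inE.
Qed.

(** * Floors, numerators and denominators of rationals *)

Section Fractions.
Local Open Scope ring_scope.

(** When q is not natural its ceiling is its floor plus one, which is also the value of [nu] at a
    natural q with the floor being q. *)
Lemma nu_subn1 (q : rat) : 0 <= q -> (nu q - 1)%N = Num.truncn q.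
Proof.
move=> q0; rewrite /nu; case: ifPn => [_|qN]; first by rewrite subn1.
have tq : (Num.truncn q)%:R != q.
  by apply: contraNN qN => /eqP <-; exact: natr_nat.
have /andP[tl tr] := truncn_itv q0.
suff -> : Num.ceil q = (Num.truncn q).+1 :> int by rewrite absz_nat subn1.
apply: ceil_def; rewrite -[in X in X < _]addn1 PoszD addrK -!pmulrn.
by rewrite lt_neqAle tq tl ltW.
Qed.

Lemma fnum_gt0 f : 0 < f -> (0 < fnum f)%N.
Proof. by move=> f0; rewrite absz_gt0 numq_eq0 gt_eqF. Qed.

Lemma fden_gt0 f : (0 < fden f)%N.
Proof. by rewrite absz_gt0 denq_neq0. Qed.

Lemma divr_fnum_fden f : 0 <= f -> (fnum f)%:R / (fden f)%:R = f.
Proof.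
move=> f0; rewrite -[RHS]divq_num_den /fnum /fden !pmulrn.
by rewrite !gez0_abs ?numq_ge0 ?denq_ge0.
Qed.

Lemma fraction_scale m n : (0 < n)%N ->
  exists2 s, (0 < s)%N & m = (s * fnum (m%:R / n%:R))%N /\
                         n = (s * fden (m%:R / n%:R))%N.
Proof.
move=> n0; rewrite !pmulrn.
have [k [mE nE]] : exists k, m%:Z = k * numq (m%:~R / n%:~R) /\
                             n%:Z = k * denq (m%:~R / n%:~R).
  case: divqP => [n_eq0|k x _]; last by exists k.
  by have := n0; rewrite -ltz_nat n_eq0.
have k0 : k != 0.
  by apply: contraTneq n0 => k0; rewrite -ltz_nat nE k0 mul0r.
(* Both equations are read in absolute value, so the sign of [k] need not be determined. *)
exists `|k|%N; first by rewrite absz_gt0.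
by rewrite /fnum /fden -!abszM -mE -nE.
Qed.

End Fractions.

(** * The largest rank of a common lower bound, and blockers *)

Section MeetRank.
Context {d : Order.disp_t} {P : finTBPOrderType d} (rho : P -> nat).
Implicit Types (a b x y : P) (A B : {set P}).
Local Open Scope order_scope.

Definition meet_rank a b : nat := (\max_(x | ((x <= b) && (x <= a))%O) rho x)%N.

Lemma ideal1 a : ideal [set a] = [set x | x <= a].
Proof.
apply/setP=> x; rewrite !inE; apply/exists_inP/idP => [[y]|xa].
  by rewrite inE => /eqP ->.
by exists a => //; rewrite inE.
Qed.

Lemma meet_rank_homo a b c : b <= c -> (meet_rank a b <= meet_rank a c)%N.
Proof.
move=> bc; apply/bigmax_leqP => x /andP[xb xa].
by rewrite /meet_rank (bigD1 x) ?leq_maxl // (le_trans xb bc).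
Qed.

Hypothesis rhoP : rank_function rho.

Lemma rank_le x y : x <= y -> (rho x <= rho y)%N.
Proof. by rewrite le_eqVlt => /predU1P[->//|/(rank_lt rhoP)/ltnW]. Qed.

Lemma rank_gt0 b : (0 < rho b)%N = (b != \bot).
Proof.
have [->|b0] := eqVneq b \bot; first by rewrite rhoP.1.
by apply: leq_ltn_trans (rank_lt rhoP (_ : \bot < b)); rewrite ?lt0x.
Qed.

Lemma meet_rank_leqr a b : (meet_rank a b <= rho b)%N.
Proof. by apply/bigmax_leqP => x /andP[/rank_le]. Qed.

Lemma meet_rank_leql a b : (meet_rank a b <= rho a)%N.
Proof. by apply/bigmax_leqP => x /andP[_ /rank_le]. Qed.

(** Rank is strictly increasing, so a common lower bound with the rank of [b] is [b] itself. *)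
Lemma meet_rank_eq a b : (meet_rank a b == rho b) = (b <= a).
Proof.
apply/eqP/idP => [mE|ba]; last first.
  apply/eqP; rewrite eqn_leq meet_rank_leqr.
  by rewrite /meet_rank (bigD1 b) ?lexx ?leq_maxl.
have lb0 : (0 < #|[pred x | ((x <= b) && (x <= a))%O]|)%N.
  by apply/card_gt0P; exists \bot; rewrite inE !le0x.
have [x /andP[xb xa] xE] := eq_bigmax_cond rho lb0.
move: xb; rewrite le_eqVlt => /predU1P[<-//|/(rank_lt rhoP)].
by rewrite -xE -mE /meet_rank ltnn.
Qed.

(** An element of largest rank among those of [B] above [x] is maximal in [B]. *)
Lemma exists_maxs B x : x \in B -> exists2 y, y \in maxs B & x <= y.
Proof.
move=> xB; case: (@arg_maxnP P x [pred y | (y \in B) && (x <= y)] rho) => /=.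
  by rewrite xB lexx.
move=> y /andP[yB xy] ymax; exists y => //; rewrite inE yB /=.
apply/forall_inP => z zB; apply/negP => yz.
have := ymax z; rewrite zB (le_trans xy (ltW yz)) => /(_ isT).
by rewrite leqNgt => /negP[]; exact: rank_lt.
Qed.

Lemma exists_mins B x : x \in B -> exists2 y, y \in mins B & y <= x.
Proof.
move=> xB; case: (@arg_minnP P x [pred y | (y \in B) && (y <= x)] rho) => /=.
  by rewrite xB lexx.
move=> y /andP[yB yx] ymin; exists y => //; rewrite inE yB /=.
apply/forall_inP => z zB; apply/negP => zy.
have := ymin z; rewrite zB (le_trans (ltW zy) yx) => /(_ isT).
by rewrite leqNgt => /negP[]; exact: rank_lt.
Qed.

(** Every common lower bound lies below a maximal one, so both maxima agree; [\bot] is a common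
    lower bound, which excludes the value -1 of the empty antichain. *)
Lemma arank_ameet a b : arank rho (ameet [set b] [set a]) = meet_rank a b.
Proof.
rewrite /ameet !ideal1 /arank; set B := _ :&: _.
have [y yB _] : exists2 y, y \in maxs B & \bot <= y.
  by apply: exists_maxs; rewrite !inE !le0x.
rewrite ifN; last by apply/set0Pn; exists y.
congr Posz; apply/eqP; rewrite eqn_leq; apply/andP; split; apply/bigmax_leqP.
  move=> x; rewrite !inE => /andP[/andP[xb xa] _].
  by rewrite /meet_rank (bigD1 x) ?xb ?xa ?leq_maxl.
move=> x /andP[xb xa].
have [|z zB xz] := @exists_maxs B x; first by rewrite !inE xb xa.
by apply: leq_trans (rank_le _ _ xz) _; rewrite (bigD1 z) ?leq_maxl.
Qed.

Lemma meet_ratioE a b :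
  meet_ratio rho a b = ((meet_rank a b)%:R / (rho b)%:R)%R.
Proof. by rewrite /meet_ratio arank_ameet. Qed.

Lemma lt_meet_ratio (r : rat) a b : b != \bot ->
  (r < meet_ratio rho a b)%R = (r * (rho b)%:R < (meet_rank a b)%:R)%R.
Proof. by rewrite -rank_gt0 => b0; rewrite meet_ratioE ltr_pdivlMr ?ltr0n. Qed.

Lemma meet_ratio_eq1 a b : b != \bot -> (meet_ratio rho a b == 1)%R = (b <= a).
Proof.
rewrite -rank_gt0 => b0; rewrite meet_ratioE -meet_rank_eq.
by rewrite -(eqr_nat rat) -[RHS](inj_eq (divIf (_ : (rho b)%:R != 0 :> rat)%R))
  ?divff ?pnatr_eq0 -?lt0n.
Qed.

Lemma meet_ratio_le1 a b : b != \bot -> (meet_ratio rho a b <= 1)%R.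
Proof.
rewrite -rank_gt0 => b0.
by rewrite meet_ratioE ler_pdivrMr ?ltr0n // mul1r ler_nat meet_rank_leqr.
Qed.

(** The condition on [b] is upward closed, hence generated by its minimal elements. The first factor
    reflects the empty blocker for [j] at least the rank of [\top]. *)
Lemma mem_ofilter_blocker j A b :
  (b \in ofilter (blocker rho j A)) =
  (j < rho \top)%N && [forall a in A, (j < meet_rank a b)%N].
Proof.
rewrite inE /blocker; case: ltnP => _ /=; last first.
  by apply/exists_inP => -[x]; rewrite inE.
apply/exists_inP/forall_inP => [[x]|jb].
  rewrite !inE => /andP[/forall_inP jx _] xb a aA.
  apply: leq_trans (meet_rank_homo a _ _ xb).
  by rewrite -ltz_nat -arank_ameet jx.
have [|y yB yb] := @exists_mins
  [set x | [forall a in A, (j%:Z < arank rho (ameet [set x] [set a]))%R]] b.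
  by rewrite inE; apply/forall_inP => a aA; rewrite arank_ameet ltz_nat jb.
by exists y.
Qed.

(** * The Farey sequence and the multipliers *)

Lemma meet_ratio_Farey a b : b != \bot -> meet_ratio rho a b \in Farey rho a.
Proof.
by move=> b0; rewrite mem_sort mem_undup !inE image_f ?orbT // !inE.
Qed.

(** No member of the sequence lies strictly between [Farey_pred rho a r] and [r], nor equals [r]
    without being the predecessor. *)
Lemma Farey_pred_lt (r : rat) a f : (0 <= r)%R -> f \in Farey rho a ->
  (Farey_pred rho a r < f)%R = (r < f)%R.
Proof.
move=> r0 fF; apply/idP/idP => [|rf]; last first.
  by apply: le_lt_trans rf; exact: bigmax_le.
by apply: contraLR; rewrite -!leNgt => fr; exact: le_bigmax_seq.
Qed.

Lemma meet_ratio_scale a b : b != \bot -> (0 < meet_ratio rho a b)%R ->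
  exists2 s, s \in multipliers rho a (meet_ratio rho a b) &
    meet_rank a b = (s * fnum (meet_ratio rho a b))%N /\
    rho b = (s * fden (meet_ratio rho a b))%N.
Proof.
rewrite -rank_gt0 => b0 f0.
have [s s0] := fraction_scale (meet_rank a b) (rho b) b0.
rewrite -meet_ratioE => -[mE bE]; exists s => //.
(* The two bounds on [s] say that the meet rank is at most [rho a] and [rho b] at most the rank of
   [\top]. *)
rewrite mem_iota s0 add1n ltnS leq_min !leq_divRL ?fnum_gt0 ?fden_gt0 //.
by rewrite -mE -bE meet_rank_leql rank_le ?lex1.
Qed.

(** * Membership in [relset] and the levels that occur *)

Lemma mem_relset (r : rat) A b : (b \in relset rho r A) =
  (b != \bot) && [forall a in A, (r < meet_ratio rho a b)%R].
Proof. by rewrite inE. Qed.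

Lemma bigcap_ideal_relset (r : rat) A : (r < 1)%R ->
  (\bigcap_(a in A) ideal [set a]) :\ \bot \subset relset rho r A.
Proof.
move=> r1; apply/subsetP => b; rewrite in_setD1 mem_relset.
move=> /andP[b0 /bigcapP bA].
rewrite b0; apply/forall_inP => a /bA; rewrite ideal1 inE => ba.
by have /eqP -> : (meet_ratio rho a b == 1)%R by rewrite meet_ratio_eq1.
Qed.

Lemma relset_rank_Dset (r : rat) A b : (0 <= r)%R -> A != set0 ->
  b \in relset rho r A -> rho b \in Dset rho r A.
Proof.
move=> r0 A0; rewrite mem_relset => /andP[b0 /forall_inP rb].
rewrite mem_Dset //; apply/forall_inP => a aA; rewrite mem_cat.
(* Elements below [a] have ratio 1 and are covered by the ranks of the ideal; all others have ratio
   strictly between [r] and 1. *)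
have [ba|nba] := boolP (b <= a).
  by rewrite orbC image_f // in_setD1 b0 ideal1 inE.
have rf := rb a aA.
have [s sm [_ bE]] := meet_ratio_scale a b b0 (le_lt_trans r0 rf).
apply/orP; left; apply/flatten_mapP; exists (meet_ratio rho a b).
  rewrite mem_filter meet_ratio_Farey // Farey_pred_lt ?meet_ratio_Farey // rf.
  by rewrite lt_neqAle meet_ratio_eq1 // nba meet_ratio_le1.
by apply/mapP; exists s.
Qed.

Lemma Dset_gt0 (r : rat) A k : A != set0 -> k \in Dset rho r A -> (0 < k)%N.
Proof.
move=> A0; rewrite mem_Dset //; have /set0Pn[a aA] := A0.
move=> /forall_inP/(_ a aA); rewrite mem_cat.
case/orP => [/flatten_mapP[f _ /mapP[s]]|/imageP[e]].
  by rewrite mem_iota => /andP[s0 _] ->; rewrite muln_gt0 s0 fden_gt0.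
by rewrite in_setD1 -rank_gt0 => /andP[e0 _] ->.
Qed.

Lemma mem_relset_blocker (r : rat) A b : (0 <= r)%R -> (r < 1)%R -> b != \bot ->
  (b \in relset rho r A) =
  (b \in ofilter (blocker rho (nu (r * (rho b)%:R)%R - 1)%N A)).
Proof.
move=> r0 r1 b0; have rb0 : (0 <= r * (rho b)%:R)%R by rewrite mulr_ge0.
rewrite mem_relset b0 mem_ofilter_blocker nu_subn1 //.
(* As r < 1 and [rho b] is positive, the blocker index stays below the rank of [\top]. *)
rewrite truncn_lt_nat //= (_ : (_ < _)%R = true) /=; last first.
  apply: (@lt_le_trans _ _ (rho b)%:R%R); last by rewrite ler_nat rank_le ?lex1.
  by rewrite gtr_pMl // ltr0n rank_gt0.
apply: eq_forallb => a; rewrite lt_meet_ratio //; congr (_ ==> _).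
by rewrite truncn_lt_nat.
Qed.

(* If [s * fnum f] is the rank of [\top], the subtracted filter is empty, but
   the rank of the meet cannot exceed [s * fnum f] in that case either. *)
Lemma mem_ofilter_diff a b m : (0 < m)%N ->
  (b \in ofilter (blocker rho (m - 1)%N [set a]) :\:
         ofilter (blocker rho m [set a])) = (meet_rank a b == m).
Proof.
move=> m0; rewrite in_setD !mem_ofilter_blocker.
have all1 j :
    [forall c in [set a], (j < meet_rank c b)%N] = (j < meet_rank a b)%N.
  by apply/forall_inP/idP => [->//|jm c]; rewrite ?inE // => /eqP ->.
have mT : (meet_rank a b <= rho \top)%N.
  by rewrite (leq_trans (meet_rank_leqr a b)) ?rank_le ?lex1.
rewrite !all1 subn1 !prednK //.
apply/idP/eqP => [/and3P[mlt _ mge]|mE].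
  apply/eqP; rewrite eqn_leq mge andbT; move: mlt; rewrite negb_and -!leqNgt.
  by case/orP => // /(leq_trans mT).
by rewrite mE ltnn andbF leqnn -mE mT.
Qed.

End MeetRank.

(** * The two descriptions of [relset] *)

Theorem theorem8p4 (d : Order.disp_t) (P : finTBPOrderType d)
    (rho : P -> nat) (r : rat) (A : {set P})
    (cardP : (1 < #|P|)%N) (rhoP : rank_function rho)
    (r_ge0 : (0 <= r)%R) (r_lt1 : (r < 1)%R)
    (AP : nontrivial_antichain A) :
  relset rho r A =
    ((\bigcap_(a in A) ideal [set a]) :\ \bot%O) :|:
    \bigcup_(k <- Dset rho r A)
      (level rho k :&: ofilter (blocker rho (nu (r * k%:R)%R - 1)%N A))
  /\
  relset rho r A =
    ((\bigcap_(a in A) ideal [set a]) :\ \bot%O) :|: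
    \bigcap_(a in A)
      \bigcup_(f <- Farey rho a | (Farey_pred rho a r < f)%R)
        \bigcup_(s <- multipliers rho a f | (s * fden f)%N \in Dset rho r A)
          (level rho (s * fden f)%N :&:
             (ofilter (blocker rho (s * fnum f - 1)%N [set a]) :\:
              ofilter (blocker rho (s * fnum f)%N [set a]))).
Proof.
have /and3P[_ A0 _] := AP.
have sub := bigcap_ideal_relset rho rhoP r A r_lt1.
split; apply/setP => b; rewrite in_setU; apply/idP/orP.
- move=> bI; right; rewrite in_bigcup_seq; apply/hasP; exists (rho b).
    exact: relset_rank_Dset.
  rewrite in_setI -mem_relset_blocker // ?bI ?inE ?eqxx //.
  by move: bI; rewrite mem_relset => /andP[].
- case=> [/(subsetP sub)//|]; rewrite in_bigcup_seq => /hasP[k kD].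
  rewrite in_setI [b \in level _ _]inE => /= /andP[/eqP bk].
  rewrite -bk -mem_relset_blocker //.
  (* Levels in [Dset] are positive, so [b] is not [\bot]. *)
  by rewrite -(rank_gt0 rho rhoP) bk (Dset_gt0 rho rhoP r A).
- move=> bI; right; apply/bigcapP => a aA.
  have := bI; rewrite mem_relset => /andP[b0 /forall_inP/(_ a aA) rf].
  have f0 := le_lt_trans r_ge0 rf.
  have [s sm [mE bE]] := meet_ratio_scale rho rhoP a b b0 f0.
  (* This choice of f also serves [b] below [a], since here f = 1 is allowed. *)
  rewrite in_bigcup_seq; apply/hasP; exists (meet_ratio rho a b).
    exact: meet_ratio_Farey.
  rewrite Farey_pred_lt ?meet_ratio_Farey // rf in_bigcup_seq.
  apply/hasP; exists s => //; rewrite -bE relset_rank_Dset // in_setI.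
  rewrite [b \in level _ _]inE bE eqxx mem_ofilter_diff ?mE ?eqxx //.
  by rewrite muln_gt0 fnum_gt0 // andbT; move: sm; rewrite mem_iota => /andP[].
- case=> [/(subsetP sub)//|/bigcapP bA].
  (* The level fixes [rho b] and the difference of filters fixes the meet rank; cancelling [s] shows
     that the ratio is f, which exceeds [r]. *)
  have bf a : a \in A -> b != \bot%O /\ (r < meet_ratio rho a b)%R.
    move=> /bA; rewrite in_bigcup_seq => /hasP[f fF /andP[]].
    rewrite Farey_pred_lt // => rf; rewrite in_bigcup_seq => /hasP[s].
    rewrite mem_iota in_setI [b \in level _ _]inE => /andP[s0 _].
    have f0 := le_lt_trans r_ge0 rf.
    case/and3P => _ /eqP bE; rewrite mem_ofilter_diff //; last first.
      by rewrite muln_gt0 s0 fnum_gt0.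
    move=> /eqP mE; rewrite -(rank_gt0 rho rhoP) bE muln_gt0 s0 fden_gt0.
    split=> //; rewrite meet_ratioE // mE bE !natrM -mulf_div divff.
      by rewrite mul1r divr_fnum_fden // ltW.
    by rewrite pnatr_eq0 -lt0n.
  have /set0Pn[a aA] := A0; rewrite mem_relset (bf a aA).1.
  by apply/forall_inP => c /bf[].
Qed.
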